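(* Let $t_{\mathrm f}>0$ be fixed. Consider a two-mode semi-Markov jump linear system with modes $a$ and $b$ (the process alternates $a\to b\to a\to\cdots$). Mode $a$ has dynamics $(A_1(t),B_1(t))$, control gain $\Gamma_1(t)$ and weights $(Q_1(t),R_1(t),S_1)$; mode $b$ has $(A_2(t),B_2(t))$, $\Gamma_2(t)$, $(Q_2(t),R_2(t),S_2)$, where the gains are given bounded piecewise continuous functions. The holding time of mode $a$ is modeled by an $m$-phase phase-type model $(\Pi_a,\eta_a,\alpha_a)$ and that of mode $b$ by a $p$-phase phase-type model $(\Pi_b,\eta_b,\alpha_b)$, with $\eta_a=-\Pi_a\mathbf 1_m$, $\eta_b=-\Pi_b\mathbf 1_p$, $\alpha_a=[1,0,\dots,0]^\top\in\mathbb R^m$, $\alpha_b=[1,0,\dots,0]^\top\in\mathbb R^p$, $m,p$ arbitrary finite. The Markovianized jump process is the Markov chain on $\{1,\dots,m+p\}$ with transition rate matrix $$\bar\Pi=\begin{bmatrix}\Pi_a&\eta_a\alpha_b^\top\\ \eta_b\alpha_a^\top&\Pi_b\end{bmatrix},$$ states $1,\dots,m$ carrying the data of mode $a$ (index $1$) and states $m+1,\dots,m+p$ the data of mode $b$ (index $2$). Let $\bar A_\ell=A_\ell+B_\ell\Gamma_\ell$, $L_\ell=Q_\ell+\Gamma_\ell^\top R_\ell\Gamma_\ell$ ($\ell=1,2$), and let $\Lambda_i$, $i=1,\dots,m+p$, solve $$-\dot\Lambda_i=\bar A_{\ell(i)}^\top\Lambda_i+\Lambda_i\bar A_{\ell(i)}+L_{\ell(i)}+\sum_{j=1}^{m+p}\pi_{ij}\Lambda_j,\qquad\Lambda_i(t_{\mathrm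 f})=S_{\ell(i)},$$ where $\ell(i)=1$ for $i\le m$ and $\ell(i)=2$ otherwise, and $\bar\Pi=[\pi_{ij}]$. Then for all $t\in[0,t_{\mathrm f}]$, $$\Lambda_1(t)=\bar F_a(t_{\mathrm f}-t)\Phi_{\bar A_1}^\top(t_{\mathrm f},t)S_1\Phi_{\bar A_1}(t_{\mathrm f},t)+\int_t^{t_{\mathrm f}}\bar F_a(\tau-t)\Phi_{\bar A_1}^\top(\tau,t)L_1(\tau)\Phi_{\bar A_1}(\tau,t)d\tau+\int_t^{t_{\mathrm f}}f_a(\tau-t)\Phi_{\bar A_1}^\top(\tau,t)\Lambda_{m+1}(\tau)\Phi_{\bar A_1}(\tau,t)d\tau,$$ $$\Lambda_{m+1}(t)=\bar F_b(t_{\mathrm f}-t)\Phi_{\bar A_2}^\top(t_{\mathrm f},t)S_2\Phi_{\bar A_2}(t_{\mathrm f},t)+\int_t^{t_{\mathrm f}}\bar F_b(\tau-t)\Phi_{\bar A_2}^\top(\tau,t)L_2(\tau)\Phi_{\bar A_2}(\tau,t)d\tau+\int_t^{t_{\mathrm f}}f_b(\tau-t)\Phi_{\bar A_2}^\top(\tau,t)\Lambda_1(\tau)\Phi_{\bar A_2}(\tau,t)d\tau,$$ where $f_a(t)=\alpha_a^\top e^{\Pi_a t}\eta_a$, $\bar F_a(t)=\alpha_a^\top e^{\Pi_a t}\mathbf 1_m$, $f_b(t)=\alpha_b^\top e^{\Pi_b t}\eta_b$, $\bar F_b(t)=\alpha_b^\top e^{\Pi_b t}\mathbf 1_p$ are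 the pdfs and complementary cdfs of the holding times of modes $a$ and $b$.
   Context: A phase-type model $(\Pi,\eta,\alpha)$ with $m$ phases consists of a sub-generator matrix $\Pi\in\mathbb R^{m\times m}$ (invertible, nonnegative off-diagonal entries, negative diagonal entries, nonpositive row sums), exit vector $\eta=-\Pi\mathbf 1_m\ge0$ and starting vector $\alpha\ge0$; it describes the absorption time of a Markov chain with transient states $1,\dots,m$. $\mathbf 1_m$ is the all-ones vector. $\Phi_{M}(t,\tau)$ denotes the state transition matrix of $\dot z=M(t)z$, i.e. $\partial_t\Phi_M(t,\tau)=M(t)\Phi_M(t,\tau)$, $\Phi_M(\tau,\tau)=I$. *)

(* Defs.v *)
From HB Require Import structures.
From mathcomp Require Import all_boot all_order all_algebra.
From mathcomp Require Import all_classical all_reals all_analysis.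
Set Implicit Arguments. Unset Strict Implicit. Unset Printing Implicit Defensive.
Import Order.TTheory GRing.Theory Num.Theory.
Import numFieldNormedType.Exports.
Local Open Scope classical_set_scope.
Local Open Scope ring_scope.

Section Defs.
Variable R : realType.

Definition mxint (a b : R) (m n : nat) (F : R -> 'M[R]_(m, n)) : 'M[R]_(m, n) :=
  \matrix_(i, j) (\int[@lebesgue_measure R]_(x in `[a, b]) F x i j).

(* Piecewise continuity of a real function on [a,b]: there is a finite
   partition a = s_0 < s_1 < ... < s_k = b such that on each open piece
   (s_i, s_{i+1}) f coincides with a function continuous on the closed
   piece [s_i, s_{i+1}] (i.e. f is continuous inside each piece and has
   finite one-sided limits at the breakpoints). *)
Definition pw_continuous (a b : R) (f : R -> R) : Prop :=
  exists s : seq R,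
    sorted <%R (a :: rcons s b) /\
    forall k : nat, (k < (size s).+1)%N ->
      let u := nth a (a :: s) k in
      let v := nth b (rcons s b) k in
      exists g : R -> R, {within `[u, v], continuous g} /\
        forall x, u < x < v -> f x = g x.

Definition mx_pw_continuous (a b : R) (m n : nat) (F : R -> 'M[R]_(m, n)) :=
  forall i j, pw_continuous a b (fun t => F t i j).

Definition mx_bounded (a b : R) (m n : nat) (F : R -> 'M[R]_(m, n)) :=
  exists M : R, forall t, a <= t <= b -> forall i j, `|F t i j| <= M.

Definition mx_continuous_on (a b : R) (m n : nat) (F : R -> 'M[R]_(m, n)) :=
  forall i j, {within `[a, b], continuous (fun t => F t i j)}.

Definition expmx (n : nat) (M : 'M[R]_n) (t : R) : 'M[R]_n :=
  \matrix_(i, j) limn (fun N : nat => \sum_(k < N) (t ^+ k / (k`!)%:R * (M ^+ k) i j)).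

Definition subgenerator (n : nat) (Pi : 'M[R]_n) : Prop :=
  [/\ Pi \in unitmx,
      forall i j, i != j -> 0 <= Pi i j,
      forall i, Pi i i < 0 &
      forall i, \sum_j Pi i j <= 0].

Definition exitvec (n : nat) (Pi : 'M[R]_n) : 'cV[R]_n := - (Pi *m (const_mx 1 : 'cV[R]_n)).

Definition e1 (n : nat) : 'cV[R]_n.+1 := \col_i (i == ord0)%:R.

Definition ph_pdf (n : nat) (Pi : 'M[R]_n) (alpha : 'cV[R]_n) (t : R) : R :=
  (alpha^T *m expmx Pi t *m exitvec Pi) 0 0.
Definition ph_ccdf (n : nat) (Pi : 'M[R]_n) (alpha : 'cV[R]_n) (t : R) : R :=
  (alpha^T *m expmx Pi t *m (const_mx 1 : 'cV[R]_n)) 0 0.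

(* Phi is the state transition matrix of dz/dt = M(t) z on [0, tf] (forward
   in time), in integral (Caratheodory) form:
   Phi(t,tau) = I + int_tau^t M(s) Phi(s,tau) ds, Phi(.,tau) continuous. *)
Definition is_stm (tf : R) (n : nat) (M : R -> 'M[R]_n) (Phi : R -> R -> 'M[R]_n) :=
  forall tau, 0 <= tau <= tf ->
    mx_continuous_on tau tf (fun t => Phi t tau) /\
    forall t, tau <= t <= tf ->
      Phi t tau = 1%:M + mxint tau t (fun s => M s *m Phi s tau).

End Defs.

Section Closed.
Variable R : realType.
Definition cl_A (n k : nat) (A : R -> 'M[R]_n) (B : R -> 'M[R]_(n, k))
  (G : R -> 'M[R]_(k, n)) (t : R) : 'M[R]_n := A t + B t *m G t.
Definition cl_L (n k : nat) (Q : R -> 'M[R]_n) (Rw : R -> 'M[R]_k)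
  (G : R -> 'M[R]_(k, n)) (t : R) : 'M[R]_n := Q t + (G t)^T *m Rw t *m G t.
End Closed.

(* Main.v *)
(* Fix t and weight the conjugated matrices Phi(s,t)^T Lambda_i(s) Phi(s,t) of
   one mode by w_i(s), the i-th entry of e1^T exp(Pi (s - t)). In the derivative
   of the weighted sum, conjugation by Phi cancels the drift terms A^T Lambda_i +
   Lambda_i A, and w' = w Pi cancels the jumps between phases of the mode. Only
   the running cost (weight \sum_i w_i, the ccdf) and the jump to the first
   phase of the other mode (weight \sum_i w_i eta_i, the pdf) survive; integrating
   over [t, tf] gives the renewal equation. *)
Require Import Defs.
From HB Require Import structures.
From mathcomp Require Import all_boot all_order all_algebra.
From mathcomp Require Import all_classical all_reals all_analysis.
From mathcomp Require Import measurable_realfun ring.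
Import Order.TTheory GRing.Theory Num.Theory.
Import numFieldNormedType.Exports.
Local Open Scope classical_set_scope.
Local Open Scope ring_scope.
Set Implicit Arguments. Unset Strict Implicit. Unset Printing Implicit Defensive.

(** * Calculus for integrals of bounded measurable functions *)

Section BoundedMeasurable.
Context {R : realType}.
Implicit Types (a b x y : R) (f g F G : R -> R).

(** A class that contains the piecewise continuous data and the continuous solutions, is stable
    under sums and products, and guarantees integrability on [[a, b]]. *)
Definition bmeas a b f :=
  measurable_fun `[a, b] f /\ exists M, forall x, a <= x <= b -> `|f x| <= M.

(** Differentiation in integral form. The data may jump, so [F] need not be differentiable
    everywhere; a bounded [f] still makes it Lipschitz. *)
Definition antider a b F f :=
  [/\ bmeas a b F, bmeas a b f &
      forall x y, a <= x -> x <= y -> y <= b ->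
        F y - F x = \int[lebesgue_measure]_(s in `[x, y]) f s].

Lemma bmeas_sub a b c d f : a <= c -> d <= b -> bmeas a b f -> bmeas c d f.
Proof.
move=> ac db [mf [M fM]]; split.
  apply: measurable_funS mf => // x /=; rewrite !in_itv /= => /andP[cx xd].
  by rewrite (le_trans ac)// (le_trans xd).
by exists M => x /andP[cx xd]; apply: fM; rewrite (le_trans ac)// (le_trans xd).
Qed.

Lemma bmeas_integrable a b f :
  bmeas a b f -> lebesgue_measure.-integrable `[a, b] (EFin \o f).
Proof.
move=> [mf [M fM]]; apply: measurable_bounded_integrable => //=.
  by rewrite lebesgue_measure_itv /=; case: ifP => // _; rewrite -EFinB ltry.
exists M; split; first exact: num_real.
move=> N MN x /=; rewrite in_itv /= => /fM fxM.
exact: le_trans (ltW MN).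
Qed.

Lemma bmeas_cst a b c : bmeas a b (fun=> c).
Proof. by split; [exact: measurable_cst | exists `|c|]. Qed.

Lemma eq_bmeas a b f g :
  (forall x, a <= x <= b -> f x = g x) -> bmeas a b f -> bmeas a b g.
Proof.
move=> fg [mf [M fM]]; split; last by exists M => x xab; rewrite -fg// fM.
by apply: eq_measurable_fun mf => x; rewrite inE /= in_itv /= => /fg.
Qed.

Lemma bmeasD a b f g : bmeas a b f -> bmeas a b g ->
  bmeas a b (fun x => f x + g x).
Proof.
move=> [mf [M fM]] [mg [N gN]]; split; first exact: measurable_funD.
by exists (M + N) => x ab; rewrite (le_trans (ler_normD _ _))// lerD ?fM ?gN.
Qed.

Lemma bmeasM a b f g : bmeas a b f -> bmeas a b g ->
  bmeas a b (fun x => f x * g x).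
Proof.
move=> [mf [M fM]] [mg [N gN]]; split; first exact: measurable_funM.
by exists (M * N) => x ab; rewrite normrM ler_pM ?fM ?gN.
Qed.

Lemma bmeasN a b f : bmeas a b f -> bmeas a b (fun x => - f x).
Proof.
move=> bf; apply: eq_bmeas (bmeasM (bmeas_cst a b (-1)) bf) => x _.
by rewrite mulN1r.
Qed.

Lemma bmeas_sum a b (I : Type) (s : seq I) (P : pred I) (f : I -> R -> R) :
  (forall i, P i -> bmeas a b (f i)) ->
  bmeas a b (fun x => \sum_(i <- s | P i) f i x).
Proof.
move=> bf; elim: s => [|i s IH].
  apply: (eq_bmeas (f := fun=> 0)) (bmeas_cst _ _ _) => x _.
  by rewrite big_nil.
case Pi: (P i).
  apply: eq_bmeas (bmeasD (bf i Pi) IH) => x _; by rewrite big_cons Pi.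
by apply: eq_bmeas IH => x _; rewrite big_cons Pi.
Qed.

Lemma bmeas_continuous a b f : {within `[a, b], continuous f} -> bmeas a b f.
Proof.
move=> cf; split; first exact: subspace_continuous_measurable_fun.
have [ab|ba] := leP a b; last first.
  by exists 0 => x /andP[ax xb]; have := le_lt_trans (le_trans ax xb) ba; rewrite ltxx.
have [c _ fc] := EVT_max ab cf; have [d _ fd] := EVT_min ab cf.
exists (`|f c| + `|f d|) => x xab.
have := fc x; have := fd x; rewrite in_itv /= => /(_ xab) h1 /(_ xab) h2.
rewrite ler_norml; apply/andP; split.
  rewrite lerNl (le_trans (y := - f d)) ?lerN2//.
  by rewrite (le_trans (ler_norm _))// normrN lerDr.
by rewrite (le_trans h2)// (le_trans (ler_norm _))// lerDl.
Qed.

Lemma Rint_chasles a b x f : bmeas a b f -> a <= x -> x <= b ->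
  \int[lebesgue_measure]_(s in `[a, b]) f s =
  \int[lebesgue_measure]_(s in `[a, x]) f s +
  \int[lebesgue_measure]_(s in `[x, b]) f s.
Proof.
move=> bf ax xb.
have := @Rintegral_itvB _ f (BLeft a) (BRight b) x (bmeas_integrable bf).
rewrite !bnd_simp => /(_ ax xb).
(* The difference of integrals lives on the half-open []x, b]]; adding the null point [x] closes
   it. *)
rewrite Rintegral_itv_obnd_cbnd => [<-|]; first by rewrite addrC subrK.
have bxb : bmeas x b f by exact: bmeas_sub bf.
apply: integrableS (bmeas_integrable bxb) => //.
by move=> z /=; rewrite !in_itv /= => /andP[/ltW -> ->].
Qed.

Lemma antider_left a b F f : bmeas a b F -> bmeas a b f ->
  (forall x, a <= x <= b -> F x = F a + \int[lebesgue_measure]_(s in `[a, x]) f s) ->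
  antider a b F f.
Proof.
move=> bF bf Ff; split=> // x y ax xy yb.
have ay := le_trans ax xy; have xb := le_trans xy yb.
rewrite (Ff y) ?ay// (Ff x) ?ax// (@Rint_chasles a y x)//.
  by ring.
exact: bmeas_sub bf.
Qed.

(** The form suited to a terminal-value problem: the integral runs from [x] up to [b], which
    reverses the sign of the density. *)
Lemma antider_right a b F f : bmeas a b F -> bmeas a b f ->
  (forall x, a <= x <= b -> F x = F b + \int[lebesgue_measure]_(s in `[x, b]) f s) ->
  antider a b F (fun x => - f x).
Proof.
move=> bF bf Ff; split=> //; first exact: bmeasN.
move=> x y ax xy yb.
have ay := le_trans ax xy; have xb := le_trans xy yb.
have bfxb : bmeas x b f by exact: bmeas_sub bf.
have bfxy : bmeas x y f by exact: bmeas_sub bf.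
rewrite (Ff y) ?ay// (Ff x) ?ax// (@Rint_chasles x b y)//.
under [RHS]eq_Rintegral do rewrite -mulN1r.
rewrite RintegralZl//; last exact: bmeas_integrable.
by ring.
Qed.

Lemma eq_antider a b F f G g :
  (forall x, a <= x <= b -> F x = G x) ->
  (forall x, a <= x <= b -> f x = g x) -> antider a b F f -> antider a b G g.
Proof.
move=> FG fg [bF bf Ff]; split; [exact: eq_bmeas bF|exact: eq_bmeas bf|].
move=> x y ax xy yb; have ay := le_trans ax xy; have xb := le_trans xy yb.
rewrite -FG ?ay// -FG ?ax// Ff//; apply: eq_Rintegral => z.
rewrite inE /= in_itv /= => /andP[xz zy].
by rewrite fg// (le_trans ax)// (le_trans zy).
Qed.

Lemma antiderD a b F f G g : antider a b F f -> antider a b G g ->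
  antider a b (fun x => F x + G x) (fun x => f x + g x).
Proof.
move=> [bF bf Ff] [bG bg Gg]; split; [exact: bmeasD..|move=> x y ax xy yb].
rewrite RintegralD//; last 2 first.
- by apply: bmeas_integrable; exact: bmeas_sub bf.
- by apply: bmeas_integrable; exact: bmeas_sub bg.
by rewrite -Ff// -Gg// opprD addrACA.
Qed.

Lemma antider_cst a b c : antider a b (fun=> c) (fun=> 0).
Proof.
split; [exact: bmeas_cst..|move=> x y _ _ _].
by rewrite Rintegral_cst// mul0r subrr.
Qed.

Lemma antider_sum a b (I : Type) (s : seq I) (P : pred I) (F f : I -> R -> R) :
  (forall i, P i -> antider a b (F i) (f i)) ->
  antider a b (fun x => \sum_(i <- s | P i) F i x)
              (fun x => \sum_(i <- s | P i) f i x).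
Proof.
move=> Ff; elim: s => [|i s IH].
  by apply: eq_antider (antider_cst _ _ 0) => x _; rewrite big_nil.
case Pi: (P i).
  by apply: eq_antider (antiderD (Ff i Pi) IH) => x _; rewrite big_cons Pi.
by apply: eq_antider IH => x _; rewrite big_cons Pi.
Qed.

Lemma Rint_bound x y f M : x <= y -> bmeas x y f ->
  (forall z, x <= z <= y -> `|f z| <= M) ->
  `|\int[lebesgue_measure]_(s in `[x, y]) f s| <= M * (y - x).
Proof.
move=> xy bf fM.
have if_ := bmeas_integrable bf.
apply: (le_trans (le_normr_Rintegral _ if_)) => //.
have -> : M * (y - x) = \int[lebesgue_measure]_(s in `[x, y]) M.
  rewrite Rintegral_cst//= lebesgue_measure_itv /= lte_fin.
  by move: xy; rewrite le_eqVlt => /orP[/eqP ->|->//]; rewrite ltxx subrr.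
apply: le_Rintegral => //.
- exact: integrable_norm if_.
- exact: bmeas_integrable (bmeas_cst _ _ _).
Qed.

(* Halving [x, y] halves the quadratic bound, so the increment vanishes. *)
Lemma quadratic_increment_eq0 a b (D : R -> R) (C : R) :
  (forall x y, a <= x -> x <= y -> y <= b -> `|D y - D x| <= C * (y - x) ^+ 2) ->
  forall x y, a <= x -> x <= y -> y <= b -> D y = D x.
Proof.
move=> DC.
have half k : forall x y, a <= x -> x <= y -> y <= b ->
    `|D y - D x| <= C * (y - x) ^+ 2 / 2 ^+ k.
  elim: k => [|k IH] x y ax xy yb; first by rewrite expr0 divr1 DC.
  have [xm my] := midf_le xy; set m := (x + y) / 2 in xm my.
  rewrite -(subrK (D m) (D y)) -addrA (le_trans (ler_normD _ _))//.
  have h1 := IH x m ax xm (le_trans my yb).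
  have h2 := IH m y (le_trans ax xm) my yb.
  (* Two squares of half the length add up to half the full square, so the two bounds sum to exactly
     the bound for [k.+1]. *)
  rewrite (le_trans (lerD h2 h1))// le_eqVlt; apply/orP; left; apply/eqP.
  rewrite /m [2 ^+ k.+1]exprS; field.
  by rewrite expf_neq0.
move=> x y ax xy yb; apply/eqP; rewrite -subr_eq0 -normr_eq0 eq_le normr_ge0 andbT.
set K := C * (y - x) ^+ 2 in half *.
have cv : K / 2 ^+ k @[k --> \oo] --> (0 : R).
  rewrite -[X in _ --> X](mulr0 K); apply: cvgMr.
  under eq_fun do rewrite -exprVn.
  by apply: cvg_expr; rewrite ger0_norm// invf_lt1// ltr1n.
rewrite -(cvg_lim _ cv)//; apply: limr_ge; first exact: cvgP cv.
by near=> k; exact: half.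
Unshelve. all: by end_near. Qed.


(* The product FG and the integral of fG + Fg have increments differing by
   O((y - x)^2), because F and G are Lipschitz. *)
Lemma antiderM a b F f G g : antider a b F f -> antider a b G g ->
  antider a b (fun x => F x * G x) (fun x => f x * G x + F x * g x).
Proof.
move=> [bF bf Ff] [bG bg Gg].
have bh : bmeas a b (fun x => f x * G x + F x * g x).
  by apply: bmeasD; exact: bmeasM.
split=> //; first exact: bmeasM.
have [_ [M fM]] := bf; have [_ [N gN]] := bg.
(* [D] is the product minus the primitive of the claimed density; the product rule says that [D] is
   constant. *)
pose D y := F y * G y - \int[lebesgue_measure]_(s in `[a, y]) (f s * G s + F s * g s).
suff DC x y : a <= x -> x <= y -> y <= b -> `|D y - D x| <= (2 * M * N) * (y - x) ^+ 2.
  move=> x y ax xy yb; have := quadratic_increment_eq0 DC ax xy yb.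
  rewrite /D (@Rint_chasles a y x)//; last by exact: bmeas_sub bh.
  by move=> /eqP; rewrite subr_eq => /eqP ->; ring.
move=> ax xy yb.
have sub h : bmeas a b h -> bmeas x y h by exact: bmeas_sub.
have sub0 h : bmeas a b h -> lebesgue_measure.-integrable `[x, y] (EFin \o h).
  by move=> /sub/bmeas_integrable.
have in_ab z : x <= z <= y -> a <= z <= b.
  by move=> /andP[xz zy]; rewrite (le_trans ax)// (le_trans zy).
have M0 : 0 <= M by apply: le_trans (fM x _); rewrite ?ax ?(le_trans xy).
have N0 : 0 <= N by apply: le_trans (gN x _); rewrite ?ax ?(le_trans xy).
have bu : bmeas a b (fun s => f s * (G y - G s)).
  apply: bmeasM => //; apply: bmeasD; [exact: bmeas_cst|exact: bmeasN].
have bv : bmeas a b (fun s => g s * (F x - F s)).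
  apply: bmeasM => //; apply: bmeasD; [exact: bmeas_cst|exact: bmeasN].
(* Write the increment of [F * G] as [(F y - F x) * G y + F x * (G y - G x)] and each difference as
   an integral; subtracting the claimed density leaves these two errors. *)
have -> : D y - D x =
    \int[lebesgue_measure]_(s in `[x, y]) (f s * (G y - G s)) +
    \int[lebesgue_measure]_(s in `[x, y]) (g s * (F x - F s)).
  rewrite -RintegralD//; [|exact: sub0..].
  have -> : \int[lebesgue_measure]_(s in `[x, y])
      (f s * (G y - G s) + g s * (F x - F s)) =
    \int[lebesgue_measure]_(s in `[x, y])
      ((f s * G y + g s * F x) - (f s * G s + F s * g s)).
    by apply: eq_Rintegral => z _; ring.
  rewrite RintegralB//; last 2 first.
  - by apply: sub0; apply: bmeasD; apply: bmeasM => //; exact: bmeas_cst.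
  - exact: sub0.
  rewrite RintegralD//; last 2 first.
  - by apply: sub0; apply: bmeasM => //; exact: bmeas_cst.
  - by apply: sub0; apply: bmeasM => //; exact: bmeas_cst.
  rewrite !RintegralZr//; [|exact: sub0..].
  rewrite -Ff// -Gg// /D (@Rint_chasles a y x)//; last by exact: bmeas_sub bh.
  by ring.
have Lip h H K : bmeas a b h -> (forall z, a <= z <= b -> `|h z| <= K) ->
    (forall u v, a <= u -> u <= v -> v <= b ->
      H v - H u = \int[lebesgue_measure]_(s in `[u, v]) h s) ->
    forall u v, x <= u -> u <= v -> v <= y -> `|H v - H u| <= K * (v - u).
  move=> bh' hK Hh u v xu uv vy.
  have au := le_trans ax xu; have vb := le_trans vy yb.
  rewrite Hh//; apply: Rint_bound => //; first exact: bmeas_sub bh'.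
  move=> z /andP[uz zv]; apply: hK.
  by rewrite (le_trans au)// (le_trans zv).
(* Each integrand is at most [M * N * (y - x)]: one factor is bounded by its supremum, the other by
   the Lipschitz constant times the length. Integration supplies the second factor [y - x]. *)
have -> : 2 * M * N * (y - x) ^+ 2 = M * N * (y - x) * (y - x) + M * N * (y - x) * (y - x) by ring.
rewrite (le_trans (ler_normD _ _))// lerD//; apply: Rint_bound => //; [exact: sub|idtac|exact: sub|idtac].
- move=> z xzy; move/andP: (xzy) => [xz zy].
  rewrite normrM -mulrA ler_pM//; first by rewrite fM// in_ab.
  rewrite (le_trans (Lip g G N bg gN Gg _ _ xz zy (lexx y)))//.
  by rewrite ler_wpM2l// lerD2l lerN2.
- move=> z xzy; move/andP: (xzy) => [xz zy].
  rewrite normrM [M * N]mulrC -mulrA ler_pM//; first by rewrite gN// in_ab.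
  rewrite distrC (le_trans (Lip f F M bf fM Ff _ _ (lexx x) xz zy))//.
  by rewrite ler_wpM2l// lerD2r.
Qed.

(** The fundamental theorem of calculus; it brings the matrix exponential into this calculus. *)
Lemma antider_of_derive a b F f :
  (forall x : R, is_derive x (1 : R) F (f x)) -> continuous f -> antider a b F f.
Proof.
move=> dF cf.
have cF : continuous F.
  move=> x; apply: differentiable_continuous; apply/derivable1_diffP.
  exact: (@ex_derive _ _ _ _ _ _ _ (dF x)).
split.
- by apply: bmeas_continuous; apply: continuous_subspaceT.
- by apply: bmeas_continuous; apply: continuous_subspaceT.
move=> x y _ xy _; move: xy; rewrite le_eqVlt => /orP[/eqP ->|xy].
  by rewrite subrr set_itv1 Rintegral_set1.
rewrite /Rintegral (@continuous_FTC2 _ f F x y)//.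
- exact: continuous_subspaceT.
- split.
  + by move=> z _; exact: (@ex_derive _ _ _ _ _ _ _ (dF z)).
  + by apply: cvg_at_right_filter; exact: cF.
  + by apply: cvg_at_left_filter; exact: cF.
- by move=> z _; rewrite derive1E; exact: (@derive_val _ _ _ _ _ _ _ (dF z)).
Qed.

(** The values of [f] at the endpoints are arbitrary, but adding single points to []a, b[] preserves
    measurability. *)
Lemma measurable_fun_eq_continuous a b f g : {within `[a, b], continuous g} ->
  (forall x, a < x < b -> f x = g x) -> measurable_fun `[a, b] f.
Proof.
move=> cg fg; apply: (@measurable_fun_itv_cc _ _ _ false true).
have mg : measurable_fun `]a, b[ g.
  apply: measurable_funS (subspace_continuous_measurable_fun _ cg) => //.
  exact: subset_itv_oo_cc.
by apply: eq_measurable_fun mg => x; rewrite inE /= in_itv /= => /fg.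
Qed.

(** Induction on the list of breakpoints, splitting off the leftmost piece [[a, c]]. *)
Lemma pw_continuous_measurable a b f :
  pw_continuous a b f -> measurable_fun `[a, b] f.
Proof.
move=> [s]; elim: s a => [|c s IH] a [/= sab pc].
  have [g [cg fg]] := pc 0%N isT.
  exact: measurable_fun_eq_continuous cg fg.
move: sab => /andP[ac scb].
have cb : c <= b.
  have := order_path_min lt_trans scb; move/allP => /(_ b).
  by rewrite mem_rcons inE eqxx => /(_ isT)/ltW.
have -> : `[a, b]%classic = `[a, c]%classic `|` `[c, b]%classic.
  apply/seteqP; split=> x /=; rewrite !in_itv /=.
    by move=> /andP[ax xb]; have [xc|/ltW cx] := leP x c; [left|right]; apply/andP.
  move=> [/andP[-> xc]|/andP[cx ->]]; first by rewrite (le_trans xc).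
  by rewrite (le_trans (ltW ac)).
apply/measurable_funU => //; split.
  have [g [cg fg]] := pc 0%N isT.
  exact: measurable_fun_eq_continuous cg fg.
apply: IH; split=> // k ks; have := pc k.+1 ks => /=.
(* Dropping the first piece changes the default of [nth] from [a] to [c], which is harmless for an
   index in range. *)
by rewrite (set_nth_default c)//.
Qed.

End BoundedMeasurable.

(** * The matrix exponential as an entrywise power series *)

Section Expmx.
Context {R : realType}.
Implicit Types (n q : nat).

(** Coefficients of an entry of [expmx M t *m X]. The free factor [X] keeps the family closed under
    differentiation, which replaces [X] by [M *m X]. *)
Definition expmx_coef n q (M : 'M[R]_n) (X : 'M[R]_(n, q)) i j (k : nat) : R :=
  (M ^+ k *m X) i j / k`!%:R.

Lemma expmx_coef_diffs n q (M : 'M[R]_n) (X : 'M[R]_(n, q)) i j :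
  pseries_diffs (expmx_coef M X i j) = expmx_coef M (M *m X) i j.
Proof.
apply/funext => k; rewrite /pseries_diffs /expmx_coef exprSr mulmxA mulmxE.
rewrite factS natrM; field.
by rewrite nat1r !pnatr_eq0 -lt0n fact_gt0.
Qed.

(** [K] sums the absolute values of all entries of [M], so it dominates every row sum, and each
    further power of [M] costs at most one factor [K]. *)
Lemma expmx_coef_bound n q (M : 'M[R]_n) (X : 'M[R]_(n, q)) :
  exists K C : R, [/\ 0 <= K, 0 <= C &
    forall k i j, `|(M ^+ k *m X) i j| <= K ^+ k * C].
Proof.
exists (\sum_i \sum_l `|M i l|), (\sum_i \sum_j `|X i j|); split.
- by apply: sumr_ge0 => i _; apply: sumr_ge0.
- by apply: sumr_ge0 => i _; apply: sumr_ge0.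
elim=> [|k IH] i j.
  rewrite !expr0 mul1r mul1mx (bigD1 i)//= (bigD1 j)//= -addrA lerDl.
  by rewrite addr_ge0// sumr_ge0// => l _; rewrite sumr_ge0.
rewrite exprS -mulmxE -mulmxA mxE (le_trans (ler_norm_sum _ _ _))//.
rewrite exprS -mulrA; set c := _ ^+ k * _.
apply: (@le_trans _ _ (\sum_l `|M i l| * c)).
  by apply: ler_sum => l _; rewrite normrM ler_wpM2l.
rewrite -mulr_suml ler_wpM2r//.
  by rewrite /c mulr_ge0// ?exprn_ge0//; apply: sumr_ge0 => ? _; apply: sumr_ge0.
by rewrite [leRHS](bigD1 i)//= lerDl; apply: sumr_ge0 => ? _; apply: sumr_ge0.
Qed.

(** Comparison with [C] times the scalar exponential series at [K] times the absolute value of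
    [x]. *)
Lemma expmx_coef_cvg n q (M : 'M[R]_n) (X : 'M[R]_(n, q)) i j x :
  cvgn (pseries (expmx_coef M X i j) x).
Proof.
have [K [C [K0 C0 KC]]] := expmx_coef_bound M X.
apply: normed_cvg.
apply: (@series_le_cvg _ _ (fun k => C * exp_coeff (K * `|x|) k)).
- by move=> k; exact: normr_ge0.
- by move=> k; rewrite mulr_ge0// exp_coeff_ge0// mulr_ge0.
- move=> k; rewrite /expmx_coef /exp_coeff /= !normrM normfV normrX normr_nat.
  have h := KC k i j.
  rewrite exprMn [leLHS]mulrAC.
  have -> : C * (K ^+ k * `|x| ^+ k / k`!%:R) = K ^+ k * C * `|x| ^+ k / k`!%:R.
    by ring.
  by rewrite !ler_wpM2r// ?exprn_ge0// invr_ge0.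
- by apply: is_cvg_seriesZ; exact: is_cvg_series_exp_coeff.
Qed.

Lemma expmxE n (M : 'M[R]_n) t i j :
  expmx M t i j = limn (pseries (expmx_coef M 1%:M i j) t).
Proof.
rewrite mxE; congr (limn _); apply/funext => N.
rewrite /pseries /series /= big_mkord; apply: eq_bigr => k _.
by rewrite /expmx_coef mulmx1 mulrC mulrA mulrAC.
Qed.

Lemma expmx_mulE n q (M : 'M[R]_n) (X : 'M[R]_(n, q)) i j t :
  (expmx M t *m X) i j = limn (pseries (expmx_coef M X i j) t).
Proof.
apply/esym/cvg_lim => //; rewrite mxE.
have -> : pseries (expmx_coef M X i j) t =
    (fun N => \sum_l pseries (expmx_coef M 1%:M i l) t N * X l j).
  apply/funext => N; rewrite /pseries /series /=.
  under [RHS]eq_bigr do rewrite mulr_suml.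
  rewrite exchange_big /=; apply: eq_bigr => k _.
  rewrite /expmx_coef mxE mulrAC 2!mulr_suml; apply: eq_bigr => l _.
  rewrite mulmx1; ring.
apply: cvg_big => [|l _]; first exact: add_continuous.
 rewrite expmxE; apply: cvgMl.
exact: expmx_coef_cvg.
Qed.

Lemma is_derive_expmx_mul n q (M : 'M[R]_n) (X : 'M[R]_(n, q)) i j (t : R) :
  is_derive t (1 : R) (fun t => (expmx M t *m X) i j) ((expmx M t *m (M *m X)) i j).
Proof.
rewrite expmx_mulE; under eq_fun do rewrite expmx_mulE.
rewrite -expmx_coef_diffs.
(* Termwise differentiation requires convergence at some point of modulus larger than that of [t];
   the series converge everywhere, so any such point will do. *)
apply: (@pseries_snd_diffs _ _ (`|t| + 1)); rewrite ?expmx_coef_diffs;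
  [exact: expmx_coef_cvg..|].
by rewrite [ltRHS]ger0_norm ?addr_ge0// ltrDl.
Qed.

Lemma expmx0 n (M : 'M[R]_n) : expmx M 0 = 1%:M.
Proof.
apply/matrixP => i j; rewrite expmxE; apply: cvg_lim => //.
(* The partial sum for [N = 0] is empty; from [N = 1] on only the term of index zero contributes. *)
apply: cvg_near_cst; exists 1%N => //= N /= N0.
rewrite /pseries /series /= -(prednK N0) big_nat_recl//= expr0 mulr1.
rewrite big1 ?addr0; last by move=> k _; rewrite exprS mul0r mulr0.
by rewrite /expmx_coef expr0 mulmx1 fact0 divr1.
Qed.

Lemma antider_expmx a b n q (M : 'M[R]_n) (X : 'M[R]_(n, q)) t i j :
  antider a b (fun s => (expmx M (s - t) *m X) i j)
              (fun s => (expmx M (s - t) *m (M *m X)) i j).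
Proof.
have d Y (s : R) : is_derive s (1 : R) (fun s => (expmx M (s - t) *m Y) i j)
    ((expmx M (s - t) *m (M *m Y)) i j).
  have ds : is_derive s (1 : R) (shift (- t)) (1 : R) by exact: is_derive_shift.
  have := @is_derive1_comp _ (fun s => (expmx M s *m Y) i j) (shift (- t)) s _ _
    (is_derive_expmx_mul M Y i j (s - t)) ds.
  by rewrite mulr1.
apply: antider_of_derive => s.
(* The derivative has the same shape with [M *m X] in place of [X], so it is itself differentiable,
   hence continuous. *)
apply: differentiable_continuous; apply/derivable1_diffP.
exact: (@ex_derive _ _ _ _ _ _ _ (d (M *m X) s)).
Qed.

End Expmx.

(** * Entrywise extension of the calculus to matrices *)

Section MatrixAntider.
Context {R : realType}.
Implicit Types (a b : R).

Definition mx_bmeas a b m n (F : R -> 'M[R]_(m, n)) :=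
  forall i j, bmeas a b (fun x => F x i j).

Definition mx_antider a b m n (F f : R -> 'M[R]_(m, n)) :=
  forall i j, antider a b (fun x => F x i j) (fun x => f x i j).

Lemma mx_bmeas_pw a b m n (F : R -> 'M[R]_(m, n)) :
  mx_pw_continuous a b F -> mx_bounded a b F -> mx_bmeas a b F.
Proof.
move=> pF [M FM] i j; split; first exact: pw_continuous_measurable.
by exists M => x xab; exact: FM.
Qed.

Lemma mx_bmeas_continuous a b m n (F : R -> 'M[R]_(m, n)) :
  mx_continuous_on a b F -> mx_bmeas a b F.
Proof. by move=> cF i j; apply: bmeas_continuous; exact: cF. Qed.

Lemma mx_bmeas_sub a b c d m n (F : R -> 'M[R]_(m, n)) :
  a <= c -> d <= b -> mx_bmeas a b F -> mx_bmeas c d F.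
Proof. by move=> ac db bF i j; exact: bmeas_sub (bF i j). Qed.

Lemma mx_bmeasD a b m n (F G : R -> 'M[R]_(m, n)) :
  mx_bmeas a b F -> mx_bmeas a b G -> mx_bmeas a b (fun x => F x + G x).
Proof.
move=> bF bG i j; apply: eq_bmeas (bmeasD (bF i j) (bG i j)) => x _.
by rewrite mxE.
Qed.

Lemma mx_bmeas_sum a b m n (I : Type) (s : seq I) (F : I -> R -> 'M[R]_(m, n)) :
  (forall k, mx_bmeas a b (F k)) -> mx_bmeas a b (fun x => \sum_(k <- s) F k x).
Proof.
move=> bF i j; apply: eq_bmeas (bmeas_sum s (P := xpredT) (fun k _ => bF k i j)).
by move=> x _; rewrite summxE.
Qed.

Lemma mx_bmeasM a b m n q (F : R -> 'M[R]_(m, n)) (G : R -> 'M[R]_(n, q)) :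
  mx_bmeas a b F -> mx_bmeas a b G -> mx_bmeas a b (fun x => F x *m G x).
Proof.
move=> bF bG i j.
apply: eq_bmeas (bmeas_sum _ (P := xpredT) (fun k _ => bmeasM (bF i k) (bG k j))).
by move=> x _; rewrite mxE.
Qed.

Lemma mx_bmeasZ a b m n (c : R -> R) (F : R -> 'M[R]_(m, n)) :
  bmeas a b c -> mx_bmeas a b F -> mx_bmeas a b (fun x => c x *: F x).
Proof.
move=> bc bF i j; apply: eq_bmeas (bmeasM bc (bF i j)) => x _.
by rewrite mxE.
Qed.

Lemma mx_bmeas_tr a b m n (F : R -> 'M[R]_(m, n)) :
  mx_bmeas a b F -> mx_bmeas a b (fun x => (F x)^T).
Proof. by move=> bF i j; apply: eq_bmeas (bF j i) => x _; rewrite mxE. Qed.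

Lemma eq_mx_antider a b m n (F f G g : R -> 'M[R]_(m, n)) :
  (forall x, a <= x <= b -> F x = G x) ->
  (forall x, a <= x <= b -> f x = g x) -> mx_antider a b F f -> mx_antider a b G g.
Proof.
by move=> FG fg Ff i j; apply: eq_antider (Ff i j) => x xab; rewrite ?FG ?fg.
Qed.

Lemma mx_antider_sum a b m n (I : Type) (s : seq I) (F f : I -> R -> 'M[R]_(m, n)) :
  (forall k, mx_antider a b (F k) (f k)) ->
  mx_antider a b (fun x => \sum_(k <- s) F k x) (fun x => \sum_(k <- s) f k x).
Proof.
move=> Ff i j.
by apply: eq_antider (antider_sum s (P := xpredT) (fun k _ => Ff k i j)) => x _;
  rewrite summxE.
Qed.

(** The scalar product rule applied to every term of the matrix product; the order of the factors is
    kept. *)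
Lemma mx_antiderM a b m n q (F f : R -> 'M[R]_(m, n)) (G g : R -> 'M[R]_(n, q)) :
  mx_antider a b F f -> mx_antider a b G g ->
  mx_antider a b (fun x => F x *m G x) (fun x => f x *m G x + F x *m g x).
Proof.
move=> Ff Gg i j.
apply: eq_antider (antider_sum _ (P := xpredT) (fun k _ => antiderM (Ff i k) (Gg k j))).
  by move=> x _; rewrite mxE.
by move=> x _; rewrite !mxE -big_split.
Qed.

Lemma mx_antiderZ a b m n (c d : R -> R) (F f : R -> 'M[R]_(m, n)) :
  antider a b c d -> mx_antider a b F f ->
  mx_antider a b (fun x => c x *: F x) (fun x => d x *: F x + c x *: f x).
Proof.
move=> cd Ff i j.
by apply: eq_antider (antiderM cd (Ff i j)) => x _; rewrite !mxE.
Qed.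

Lemma mx_antider_tr a b m n (F f : R -> 'M[R]_(m, n)) :
  mx_antider a b F f -> mx_antider a b (fun x => (F x)^T) (fun x => (f x)^T).
Proof. by move=> Ff i j; apply: eq_antider (Ff j i) => x _; rewrite mxE. Qed.

Lemma mxintxx a m n (F : R -> 'M[R]_(m, n)) : mxint a a F = 0.
Proof. by apply/matrixP => i j; rewrite !mxE set_itv1 Rintegral_set1. Qed.

Lemma mxintD a b m n (F G : R -> 'M[R]_(m, n)) :
  mx_bmeas a b F -> mx_bmeas a b G ->
  mxint a b (fun x => F x + G x) = mxint a b F + mxint a b G.
Proof.
move=> bF bG; apply/matrixP => i j; rewrite !mxE -RintegralD//.
- by apply: eq_Rintegral => x _; rewrite mxE.
- exact: bmeas_integrable.
- exact: bmeas_integrable.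
Qed.

Lemma mx_antider_mxint a b m n (F f : R -> 'M[R]_(m, n)) :
  a <= b -> mx_antider a b F f -> F b - F a = mxint a b f.
Proof.
by move=> ab Ff; apply/matrixP => i j; rewrite !mxE; have [_ _ ->] := Ff i j.
Qed.

Lemma mx_antider_left a b m n (F f : R -> 'M[R]_(m, n)) :
  mx_bmeas a b F -> mx_bmeas a b f ->
  (forall x, a <= x <= b -> F x = F a + mxint a x f) -> mx_antider a b F f.
Proof.
move=> bF bf Ff i j; apply: antider_left => // x xab.
by rewrite [in LHS]Ff// !mxE.
Qed.

Lemma mx_antider_right a b m n (F f : R -> 'M[R]_(m, n)) :
  mx_bmeas a b F -> mx_bmeas a b f ->
  (forall x, a <= x <= b -> F x = F b + mxint x b f) ->
  mx_antider a b F (fun x => - f x).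
Proof.
move=> bF bf Ff i j.
apply: eq_antider (antider_right (bF i j) (bf i j) _) => // x xab.
  by rewrite mxE.
by rewrite [in LHS]Ff// !mxE.
Qed.

End MatrixAntider.

(** * The renewal equation of a single phase-type mode *)

Section Renewal.
Context {R : realType}.

(** Starting in the first phase selects the first row of [E]; this turns [ph_ccdf] and [ph_pdf] into
    weighted sums along that row. *)
Lemma e1_mulmx m (E : 'M[R]_m.+1) (v : 'cV[R]_m.+1) :
  ((e1 R m)^T *m E *m v) 0 0 = \sum_i E ord0 i * v i 0.
Proof.
rewrite mxE; apply: eq_bigr => i _; congr (_ * _).
rewrite mxE (bigD1 ord0)//= big1 ?addr0 => [|j j0]; first by rewrite !mxE eqxx mul1r.
by rewrite !mxE (negbTE j0) mul0r.
Qed.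

(** The other mode enters only through the input [V], standing for the matrix of its first phase, so
    one statement serves both equations of the theorem. *)
Lemma phase_type_renewal (tf : R) n m (Ab L V : R -> 'M[R]_n) (S : 'M[R]_n)
    (Pi : 'M[R]_m.+1) (Lam : 'I_m.+1 -> R -> 'M[R]_n) (Phi : R -> R -> 'M[R]_n) :
  mx_bmeas 0 tf Ab -> mx_bmeas 0 tf L -> mx_bmeas 0 tf V ->
  is_stm tf Ab Phi ->
  (forall i, mx_bmeas 0 tf (Lam i)) ->
  (forall i t, 0 <= t <= tf -> Lam i t = S + mxint t tf (fun s =>
    (Ab s)^T *m Lam i s + Lam i s *m Ab s + L s
    + (\sum_j Pi i j *: Lam j s + exitvec Pi i 0 *: V s))) ->
  forall t, 0 <= t <= tf ->
    Lam ord0 t =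
      ph_ccdf Pi (e1 R m) (tf - t) *: ((Phi tf t)^T *m S *m Phi tf t)
      + mxint t tf (fun tau => ph_ccdf Pi (e1 R m) (tau - t) *:
            ((Phi tau t)^T *m L tau *m Phi tau t))
      + mxint t tf (fun tau => ph_pdf Pi (e1 R m) (tau - t) *:
            ((Phi tau t)^T *m V tau *m Phi tau t)).
Proof.
move=> bA bL bV stm bLam eqLam t tin; have /andP[t0 ttf] := tin.
have sub p q (F : R -> 'M[R]_(p, q)) : mx_bmeas 0 tf F -> mx_bmeas t tf F.
  exact: mx_bmeas_sub.
have [cP eqPhi] := stm t tin.
have bP : mx_bmeas t tf (fun s => Phi s t) by exact: mx_bmeas_continuous.
have Ptt : Phi t t = 1%:M by rewrite eqPhi ?lexx// mxintxx addr0.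
have dP : mx_antider t tf (fun s => Phi s t) (fun s => Ab s *m Phi s t).
  apply: mx_antider_left => //; first by apply: mx_bmeasM => //; exact: sub.
  by move=> x xt; rewrite Ptt eqPhi.
(* The Lyapunov equation reads [- Lam' = H], so [Lam i] has density [- H i]. *)
pose H i s := (Ab s)^T *m Lam i s + Lam i s *m Ab s + L s
    + (\sum_j Pi i j *: Lam j s + exitvec Pi i 0 *: V s).
have bH i : mx_bmeas 0 tf (H i).
  apply: mx_bmeasD; last first.
    apply: mx_bmeasD; last by apply: mx_bmeasZ => //; exact: bmeas_cst.
    by apply: mx_bmeas_sum => j; apply: mx_bmeasZ => //; exact: bmeas_cst.
  apply: mx_bmeasD => //.
  by apply: mx_bmeasD; apply: mx_bmeasM => //; exact: mx_bmeas_tr.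
have Ltf i : Lam i tf = S.
  by rewrite eqLam ?mxintxx ?addr0// lexx andbT (le_trans t0).
have dLam i : mx_antider t tf (Lam i) (fun s => - H i s).
  apply: mx_antider_right; [exact: sub|exact: sub|].
  by move=> x /andP[tx xtf]; rewrite Ltf -eqLam// xtf (le_trans t0).
(* [w] is the first row of [expmx Pi (s - t)], and [w'] is that row times [Pi]. *)
pose w i s := expmx Pi (s - t) ord0 i.
pose w' i s := \sum_j w j s * Pi j i.
have dw i : antider t tf (w i) (w' i).
  apply: eq_antider (antider_expmx t tf Pi 1%:M t ord0 i) => s _.
    by rewrite mulmx1.
  by rewrite mulmx1 mxE.
have ccdfE s : ph_ccdf Pi (e1 R m) (s - t) = \sum_i w i s.
  by rewrite /ph_ccdf e1_mulmx; apply: eq_bigr => i _; rewrite [const_mx _ _ _]mxE mulr1.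
have pdfE s : ph_pdf Pi (e1 R m) (s - t) = \sum_i w i s * exitvec Pi i 0.
  by rewrite /ph_pdf e1_mulmx.
pose conj (F : 'M[R]_n) s := (Phi s t)^T *m F *m Phi s t.
(* [Y] interpolates between [Lam ord0 t] at [s = t] and the terminal-cost term at [s = tf]; [Z1] and
   [Z2] are what remains of its derivative, up to sign. *)
pose Y s := \sum_i w i s *: conj (Lam i s) s.
pose Z1 s := (ph_ccdf Pi (e1 R m) (s - t)) *: conj (L s) s.
pose Z2 s := (ph_pdf Pi (e1 R m) (s - t)) *: conj (V s) s.
have bw i : bmeas t tf (w i) by have [] := dw i.
have bconj (F : R -> 'M[R]_n) : mx_bmeas 0 tf F -> mx_bmeas t tf (fun s => conj (F s) s).
  by move=> /sub bF; do 2!apply: mx_bmeasM => //; exact: mx_bmeas_tr.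
have bZ1 : mx_bmeas t tf Z1.
  apply: mx_bmeasZ; last exact: bconj.
  apply: (eq_bmeas (f := fun s => \sum_i w i s)) => [s _|]; first by rewrite ccdfE.
  exact: bmeas_sum.
have bZ2 : mx_bmeas t tf Z2.
  apply: mx_bmeasZ; last exact: bconj.
  apply: (eq_bmeas (f := fun s => \sum_i w i s * exitvec Pi i 0)) => [s _|].
    by rewrite pdfE.
  by apply: bmeas_sum => i _; apply: bmeasM => //; exact: bmeas_cst.
have dconj i : mx_antider t tf (fun s => conj (Lam i s) s)
    (fun s => - (conj (L s) s + (\sum_j Pi i j *: conj (Lam j s) s
                 + exitvec Pi i 0 *: conj (V s) s))).
  apply: eq_mx_antider (mx_antiderM (mx_antiderM (mx_antider_tr dP) (dLam i)) dP) => //.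
  move=> s _ /=; rewrite /H /conj.
  have -> : \sum_j Pi i j *: ((Phi s t)^T *m Lam j s *m Phi s t) =
      (Phi s t)^T *m (\sum_j Pi i j *: Lam j s) *m Phi s t.
    rewrite mulmx_sumr mulmx_suml; apply: eq_bigr => j _.
    by rewrite -scalemxAr -scalemxAl.
  rewrite scalemxAl scalemxAr -!mulmxDl -!mulmxDr.
  (* All terms of [H] other than the drift are packed into [l]. The product rule yields the drift
     once from the factors [P^T] and [P] and once, negated, from [Lam i]. *)
  set P := Phi s t; set l := L s + _; set X := Lam i s.
  have -> : (Ab s)^T *m X + X *m Ab s + L s +
      (\sum_j Pi i j *: Lam j s + exitvec Pi i 0 *: V s) =
      (Ab s)^T *m X + X *m Ab s + l.
    by rewrite -addrA.
  move: l => l; rewrite trmx_mul -(mulmxA _ _ X) -mulmxDr !opprD !addrA subrr sub0r.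
  rewrite mulmxA -(mulmxA P^T X) -mulmxDl -mulmxDr.
  by rewrite addrAC addNr add0r mulmxN mulNmx.
have dY : mx_antider t tf Y (fun s => - (Z1 s + Z2 s)).
  apply: eq_mx_antider (mx_antider_sum _ (fun i => mx_antiderZ (dw i) (dconj i))) => //.
  move=> s _; rewrite /Z1 /Z2 ccdfE pdfE big_split /=.
  (* Exchanging the two sums moves [Pi] from the weights onto the matrices, where it cancels the
     jumps inside the mode. *)
  have -> : \sum_i w' i s *: conj (Lam i s) s =
      \sum_i w i s *: \sum_j Pi i j *: conj (Lam j s) s.
    under eq_bigr do rewrite scaler_suml.
    rewrite exchange_big; apply: eq_bigr => i _; rewrite scaler_sumr.
    by apply: eq_bigr => j _; rewrite scalerA.
  rewrite !scaler_suml -!big_split -sumrN /=; apply: eq_bigr => i _.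
  rewrite scalerN !scalerDr scalerA !opprD addrCA; congr (_ + _).
  by rewrite addrA subrr add0r.
have := mx_antider_mxint ttf dY.
have -> : mxint t tf (fun s => - (Z1 s + Z2 s)) = - (mxint t tf Z1 + mxint t tf Z2).
  rewrite -mxintD//; apply/matrixP => i j; rewrite !mxE -mulN1r -RintegralZl//.
    by apply: eq_Rintegral => x _; rewrite !mxE mulN1r.
  by apply: bmeas_integrable; exact: mx_bmeasD.
(* All phases share the terminal matrix [S], so the weights add up to the ccdf. *)
have -> : Y tf = ph_ccdf Pi (e1 R m) (tf - t) *: conj S tf.
  by rewrite ccdfE scaler_suml; apply: eq_bigr => i _; rewrite Ltf.
(* At [s = t] the exponential is the identity, so only the first phase has nonzero weight. *)
have -> : Y t = Lam ord0 t.
  rewrite /Y (bigD1 ord0)//= big1 ?addr0 => [|i i0].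
    by rewrite /w /conj subrr expmx0 mxE eqxx scale1r Ptt trmx1 mul1mx mulmx1.
  by rewrite /w subrr expmx0 mxE eq_sym (negbTE i0) scale0r.
move=> /eqP; rewrite subr_eq => /eqP hY; rewrite -addrA -/(conj S tf) hY.
by rewrite addrC addrA subrr add0r.
Qed.

End Renewal.

(** * Coupling of the two modes *)

(** The off-diagonal blocks have rank one: every exit enters the first phase of the other mode, so a
    whole block contributes a single matrix. *)
Lemma sum_exit_e1 (R : realType) n m q (Pi : 'M[R]_m) (i : 'I_m) (F : 'I_q.+1 -> 'M[R]_n) :
  \sum_j (exitvec Pi *m (e1 R q)^T) i j *: F j = exitvec Pi i 0 *: F ord0.
Proof.
rewrite (bigD1 ord0)//= big1 ?addr0 => [|j j0].
  by rewrite mxE big_ord1 !mxE eqxx mulr1.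
by rewrite mxE big_ord1 !mxE (negbTE j0) mulr0 scale0r.
Qed.

Theorem theorem3 (R : realType) (tf : R) (n k m p : nat)
  (A1 A2 : R -> 'M[R]_n) (B1 B2 : R -> 'M[R]_(n, k))
  (G1 G2 : R -> 'M[R]_(k, n))
  (Q1 Q2 : R -> 'M[R]_n) (R1 R2 : R -> 'M[R]_k) (S1 S2 : 'M[R]_n)
  (Pia : 'M[R]_m.+1) (Pib : 'M[R]_p.+1)
  (Lam : 'I_(m.+1 + p.+1) -> R -> 'M[R]_n)
  (Phi1 Phi2 : R -> R -> 'M[R]_n) :
  0 < tf ->
  (* data: bounded piecewise continuous on [0, tf] *)
  mx_pw_continuous 0 tf A1 -> mx_pw_continuous 0 tf A2 ->
  mx_pw_continuous 0 tf B1 -> mx_pw_continuous 0 tf B2 ->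
  mx_pw_continuous 0 tf G1 -> mx_pw_continuous 0 tf G2 ->
  mx_pw_continuous 0 tf Q1 -> mx_pw_continuous 0 tf Q2 ->
  mx_pw_continuous 0 tf R1 -> mx_pw_continuous 0 tf R2 ->
  mx_bounded 0 tf A1 -> mx_bounded 0 tf A2 ->
  mx_bounded 0 tf B1 -> mx_bounded 0 tf B2 ->
  mx_bounded 0 tf G1 -> mx_bounded 0 tf G2 ->
  mx_bounded 0 tf Q1 -> mx_bounded 0 tf Q2 ->
  mx_bounded 0 tf R1 -> mx_bounded 0 tf R2 ->
  (* phase-type models (Pi_a, eta_a, alpha_a), (Pi_b, eta_b, alpha_b) *)
  subgenerator Pia -> subgenerator Pib ->
  (* Phi1, Phi2 : state transition matrices of Abar_1, Abar_2 *)
  is_stm tf (cl_A A1 B1 G1) Phi1 ->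
  is_stm tf (cl_A A2 B2 G2) Phi2 ->
  (* Lambda_i solve the coupled Lyapunov equations with rate matrix Pibar *)
  (let Pibar : 'M[R]_(m.+1 + p.+1) :=
     block_mx Pia (exitvec Pia *m (e1 R p)^T) (exitvec Pib *m (e1 R m)^T) Pib in
   forall i : 'I_(m.+1 + p.+1),
     mx_continuous_on 0 tf (Lam i) /\
     forall t, 0 <= t <= tf ->
       Lam i t =
         (if (i < m.+1)%N then S1 else S2) +
         mxint t tf (fun s =>
           let Ab := if (i < m.+1)%N then cl_A A1 B1 G1 s else cl_A A2 B2 G2 s in
           let L := if (i < m.+1)%N then cl_L Q1 R1 G1 s else cl_L Q2 R2 G2 s in
           (Ab^T *m Lam i s + Lam i s *m Ab + L
            + \sum_(j < m.+1 + p.+1) Pibar i j *: Lam j s))) ->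
  forall t, 0 <= t <= tf ->
    Lam (lshift p.+1 (ord0 : 'I_m.+1)) t =
      ph_ccdf Pia (e1 R m) (tf - t) *: ((Phi1 tf t)^T *m S1 *m Phi1 tf t)
      + mxint t tf (fun tau => ph_ccdf Pia (e1 R m) (tau - t) *:
            ((Phi1 tau t)^T *m cl_L Q1 R1 G1 tau *m Phi1 tau t))
      + mxint t tf (fun tau => ph_pdf Pia (e1 R m) (tau - t) *:
            ((Phi1 tau t)^T *m Lam (rshift m.+1 (ord0 : 'I_p.+1)) tau *m Phi1 tau t))
  /\
    Lam (rshift m.+1 (ord0 : 'I_p.+1)) t =
      ph_ccdf Pib (e1 R p) (tf - t) *: ((Phi2 tf t)^T *m S2 *m Phi2 tf t)
      + mxint t tf (fun tau => ph_ccdf Pib (e1 R p) (tau - t) *: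
            ((Phi2 tau t)^T *m cl_L Q2 R2 G2 tau *m Phi2 tau t))
      + mxint t tf (fun tau => ph_pdf Pib (e1 R p) (tau - t) *:
            ((Phi2 tau t)^T *m Lam (lshift p.+1 (ord0 : 'I_m.+1)) tau *m Phi2 tau t)).

Proof.
move=> _ pA1 pA2 pB1 pB2 pG1 pG2 pQ1 pQ2 pR1 pR2.
move=> hA1 hA2 hB1 hB2 hG1 hG2 hQ1 hQ2 hR1 hR2 _ _ stm1 stm2 /= eqLam.
have bA A B G : mx_pw_continuous 0 tf A -> mx_bounded 0 tf A ->
    mx_pw_continuous 0 tf B -> mx_bounded 0 tf B ->
    mx_pw_continuous 0 tf G -> mx_bounded 0 tf G ->
    mx_bmeas 0 tf (@cl_A R n k A B G).
  by move=> *; apply: mx_bmeasD; [|apply: mx_bmeasM]; exact: mx_bmeas_pw.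
have bL Q W G : mx_pw_continuous 0 tf Q -> mx_bounded 0 tf Q ->
    mx_pw_continuous 0 tf W -> mx_bounded 0 tf W ->
    mx_pw_continuous 0 tf G -> mx_bounded 0 tf G ->
    mx_bmeas 0 tf (@cl_L R n k Q W G).
  move=> *; apply: mx_bmeasD; first exact: mx_bmeas_pw.
  apply: mx_bmeasM; last exact: mx_bmeas_pw.
  by apply: mx_bmeasM; [apply: mx_bmeas_tr|]; exact: mx_bmeas_pw.
have bLam i : mx_bmeas 0 tf (Lam i).
  by apply: mx_bmeas_continuous; have [] := eqLam i.
move=> t tin; split.
(* Mode [a] owns the left indices; [V] is the matrix at the first right index. *)
- apply: (phase_type_renewal (Ab := cl_A A1 B1 G1) (Lam := fun i => Lam (lshift _ i))) tin => //.
  + exact: bA.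
  + exact: bL.
  + move=> i s sin; have [_ ->//] := eqLam (lshift _ i).
    have -> : (lshift p.+1 i < m.+1)%N by exact: (ltn_ord i).
    congr (_ + mxint _ _ _); apply/funext => u; congr (_ + _).
    rewrite big_split_ord /= -(sum_exit_e1 _ _ (fun j => Lam (rshift _ j) u)); congr (_ + _).
      by apply: eq_bigr => j _; rewrite block_mxEul.
    by apply: eq_bigr => j _; rewrite block_mxEur.
- apply: (phase_type_renewal (Ab := cl_A A2 B2 G2) (Lam := fun i => Lam (rshift _ i))) tin => //.
  + exact: bA.
  + exact: bL.
  + move=> i s sin; have [_ ->//] := eqLam (rshift _ i).
    have -> : (rshift m.+1 i < m.+1)%N = false by rewrite ltnNge leq_addr.
    congr (_ + mxint _ _ _); apply/funext => u; congr (_ + _).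
    (* In the lower rows the exit block comes before [Pib], so the two partial sums are swapped
       first. *)
    rewrite big_split_ord /= addrC -(sum_exit_e1 _ _ (fun j => Lam (lshift _ j) u)); congr (_ + _).
      by apply: eq_bigr => j _; rewrite block_mxEdr.
    by apply: eq_bigr => j _; rewrite block_mxEdl.
Qed.
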